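(* Let $e_t>0$, $r>0$, $\bm{t}_0\in\mathbb{C}^Q$. Let $\mathcal{R}$ be the set of Hermitian positive semidefinite matrices $\bm{R}_s\in\mathbb{C}^{N_TL\times N_TL}$ with $\bm{R}_s(i,i)=\frac{e_t}{N_TL}$ for all $i$, and let $\Omega=\{\bm{t}\in\mathbb{C}^Q:\|\bm{t}-\bm{t}_0\|_2\le r\}$. Put $z^C(\bm{R}_s,\bm{t})=\mathrm{trace}\left(\bm{G}(\bm{t})^{\rm H}\bm{R}_c^{-1}\bm{G}(\bm{t})\bm{R}_s\right)$. Then $$\min_{\bm{t}\in\Omega}\max_{\bm{R}_s\in\mathcal{R}}z^C(\bm{R}_s,\bm{t})=\max_{\bm{R}_s\in\mathcal{R}}\min_{\bm{t}\in\Omega}z^C(\bm{R}_s,\bm{t}),$$ and a Nash equilibrium exists for the corresponding two-person zero-sum game, i.e. there is $(\bm{R}_s^*,\bm{t}^* )\in\mathcal{R}\times\Omega$ with $z^C(\bm{R}_s,\bm{t}^* )\le z^C(\bm{R}_s^*,\bm{t}^* )\le z^C(\bm{R}_s^*,\bm{t})$ for all $\bm{R}_s\in\mathcal{R}$ and $\bm{t}\in\Omega$.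
   Context: Let $N_T,N_R,L,Q\ge 1$ be integers, and let $\bm{a}\in\mathbb{C}^{N_T}$ and $\bm{b}\in\mathbb{C}^{N_R}$ be fixed vectors (the transmit and receive steering vectors). For $i=0,\dots,Q-1$ let $\bm{J}_i$ be the $(Q+L-1)\times L$ shift matrix with $\bm{J}_i(m,n)=1$ if $m-n=i$ and $0$ otherwise. For $\bm{t}\in\mathbb{C}^Q$ (the target impulse response) let $\bm{T}=\sum_{i=1}^Q\bm{t}(i)\bm{J}_{i-1}$ and $\bm{G}(\bm{t})=\bm{T}\otimes(\bm{b}\bm{a}^{\rm T})$, an $N_R(Q+L-1)\times N_TL$ matrix. $\bm{R}_c$ is a Hermitian positive definite matrix of size $N_R(Q+L-1)$ (the noise covariance). Superscript ${\rm H}$ denotes conjugate transpose. The matrix $\bm{R}_s$ is the relaxation of $\bm{s}\bm{s}^{\rm H}$ for a constant modulus waveform $\bm{s}\in\mathbb{C}^{N_TL}$; the radar player chooses $\bm{R}_s$ to maximize and the target player chooses $\bm{t}$ to minimize $z^C$. *)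

(* Defs.v *)
From mathcomp Require Import all_boot all_order all_algebra.
From mathcomp Require Import all_classical all_reals.
From mathcomp Require Import complex mxtens.

Set Implicit Arguments.
Unset Strict Implicit.
Unset Printing Implicit Defensive.

Import Order.TTheory GRing.Theory Num.Theory.
Local Open Scope ring_scope.
Local Open Scope classical_set_scope.
Local Open Scope complex_scope.
Local Open Scope sesquilinear_scope.

(* Everything is over R[i], the complex numbers over an arbitrary model R of   *)
(* the reals. Its order is partial: x <= y iff x and y have the same imaginary *)
(* part and Re x <= Re y. A comparison with a real number thus entails         *)
(* realness; no real part has to be taken in the definitions below.            *)

Section Matrices.
Variable R : realType.
Local Notation C := R[i].

Definition psdmx n (A : 'M[C]_n) : Prop :=
  A \is hermsymmx /\ forall x : 'cV[C]_n, 0 <= (x^t* *m A *m x) 0 0.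

Definition pdmx n (A : 'M[C]_n) : Prop :=
  A \is hermsymmx /\
  forall x : 'cV[C]_n, x != 0 -> 0 < (x^t* *m A *m x) 0 0.

(* The norm `|x| of MathComp-Analysis on 'cV is the sup norm. *)
Definition l2norm n (x : 'cV[C]_n) : R :=
  Num.sqrt (\sum_(i < n) ComplexField.Normc.normc (x i 0) ^+ 2).

End Matrices.

Section Extrema.
Variables (d : Order.disp_t) (V : porderType d).

Definition is_max_on (S : Type) (A : set S) (f : S -> V) (v : V) : Prop :=
  (f @` A) v /\ ubound (f @` A) v.

Definition is_min_on (S : Type) (A : set S) (f : S -> V) (v : V) : Prop :=
  (f @` A) v /\ lbound (f @` A) v.

(* v = min_(t in B) max_(x in A) f x t, all the extrema being attained; the   *)
(* inner maximum phi is determined on B, the only place where it matters.     *)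
Definition is_minmax (S T : Type) (A : set S) (B : set T) (f : S -> T -> V)
    (v : V) : Prop :=
  exists2 phi : T -> V,
    forall t, B t -> is_max_on A (f^~ t) (phi t) & is_min_on B phi v.

Definition is_maxmin (S T : Type) (A : set S) (B : set T) (f : S -> T -> V)
    (v : V) : Prop :=
  exists2 psi : S -> V,
    forall x, A x -> is_min_on B (f x) (psi x) & is_max_on A psi v.

(* Nash equilibrium of the zero-sum game in which the first player maximizes  *)
(* f over A and the second one minimizes f over B.                            *)
Definition is_nash (S T : Type) (A : set S) (B : set T) (f : S -> T -> V)
    (x : S) (t : T) : Prop :=
  [/\ A x, B t &
      forall x' t', A x' -> B t' -> f x' t <= f x t <= f x t']%O.

End Extrema.

Section Radar.
Variables (R : realType) (NT NR L Q : nat).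
Local Notation C := R[i].

(* Entry 1 where m - n = i; nat subtraction truncates, hence m = n + i.        *)
Definition shiftmx (i : nat) : 'M[C]_(Q + L - 1, L) :=
  \matrix_(m, n) ((m : nat) == n + i)%N%:R.

(* With indices starting at 0, t(i) multiplies J_(i-1) becomes t i 0 *: J_i. *)
Definition tirmx (t : 'cV[C]_Q) : 'M[C]_(Q + L - 1, L) :=
  \sum_(i < Q) t i 0 *: shiftmx i.

(* tensmx is the Kronecker product with its usual row-major block indexing;   *)
(* a^T is the plain transpose, not the conjugate one.                         *)
Definition Gmx (a : 'cV[C]_NT) (b : 'cV[C]_NR) (t : 'cV[C]_Q) :
    'M[C]_((Q + L - 1) * NR, L * NT) :=
  tensmx (tirmx t) (b *m a^T).

Definition zC (a : 'cV[C]_NT) (b : 'cV[C]_NR)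
    (Rc : 'M[C]_((Q + L - 1) * NR)) (Rs : 'M[C]_(L * NT)) (t : 'cV[C]_Q) : C :=
  \tr ((Gmx a b t)^t* *m invmx Rc *m Gmx a b t *m Rs).

Definition waveforms (et : R) : set 'M[C]_(L * NT) :=
  [set Rs | psdmx Rs /\ forall i, Rs i i = (et / (NT * L)%:R)%:C].

Definition tirs (t0 : 'cV[C]_Q) (r : R) : set 'cV[C]_Q :=
  [set t | l2norm (t - t0) <= r].

End Radar.

Arguments waveforms {R} NT L et _.

(* Main.v *)
(** The payoff is affine in [Rs], and for positive semidefinite [Rs] it is a
    nonnegative quadratic form in [t], so midpoint-convex by the parallelogram
    identity. Both strategy sets are compact and convex. If the payoff were
    strictly convex in [t], a maximin strategy [Rs] and the unique best response
    [t] to it would form a saddle point: move from [Rs] towards any [Rs'] and let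
    the step tend to 0. Strict convexity is obtained by adding [e ||t - t0||^2],
    and the saddle points for [e -> 0] accumulate at one of the original game. *)

Require Import Defs.
From mathcomp Require Import all_boot all_order all_algebra.
From mathcomp Require Import all_classical all_reals.
From mathcomp Require Import complex mxtens.
From mathcomp Require Import all_analysis.
From mathcomp Require Import ring lra.

Set Implicit Arguments.
Unset Strict Implicit.
Unset Printing Implicit Defensive.

Import Order.TTheory GRing.Theory Num.Theory.
Import numFieldNormedType.Exports.
Local Open Scope ring_scope.
Local Open Scope classical_set_scope.
Local Notation Re := complex.Re.
Local Notation Im := complex.Im.

(** * A minimax theorem on compact sets *)

(** The traces of the [S e] on [K] form a filter base, and any of its cluster points lies in the
    closure of each [S e]. This plays the role of extracting a limit as [e] tends to 0. *)
Lemma compact_nested (T : topologicalType) (R : realType) (K : set T)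
    (S : R -> set T) :
  compact K -> (forall e, 0 < e -> closed (S e)) ->
  (forall e, 0 < e -> K `&` S e !=set0) ->
  (forall e e', 0 < e -> e <= e' -> S e `<=` S e') ->
  exists2 x, K x & forall e, 0 < e -> S e x.
Proof.
move=> cK clS KS0 homoS.
pose F := filter_from [set e : R | 0 < e] (fun e => K `&` S e).
have FF : ProperFilter F.
  apply: filter_from_proper => [|e]; last exact: KS0.
  apply: filter_from_filter; first by exists 1; rewrite /= ltr01.
  move=> e e' /= e0 e'0; exists (Num.min e e') => [/=|x [Kx Sx]].
    by rewrite lt_min e0.
  have m0 : 0 < Num.min e e' by rewrite lt_min e0.
  by split; split=> //; apply: homoS Sx; rewrite // ge_min lexx ?orbT.
have FK : F K by exists 1 => [/=|x []]; rewrite ?ltr01.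
have [x [Kx]] := cK F FF FK; rewrite clusterE => clx; exists x => // e e0.
by rewrite (closure_id (S e)).1; [apply: clx; exists e => // y [] | exact: clS].
Qed.

Lemma closed_forall_in (T : topologicalType) (I : Type) (D : set I) (P : I -> set T) :
  (forall i, D i -> closed (P i)) -> closed [set x | forall i, D i -> P i x].
Proof. exact: closed_bigI. Qed.

Lemma closed_forall (T : topologicalType) (I : Type) (P : I -> set T) :
  (forall i, closed (P i)) -> closed [set x | forall i, P i x].
Proof.
move=> clP; suff -> : [set x | forall i, P i x] = \bigcap_i P i.
  by apply: closed_bigI => i _.
by apply/seteqP; split=> x /= Px i //; exact: Px.
Qed.

Lemma closed_le_continuous (T : topologicalType) (R : realType) (f : T -> R) c :
  continuous f -> closed [set x | f x <= c].
Proof.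
move=> cf; have /continuous_closedP/(_ _ (@closed_le _ c)) := cf; exact.
Qed.

Lemma closed_ge_continuous (T : topologicalType) (R : realType) (f : T -> R) c :
  continuous f -> closed [set x | c <= f x].
Proof.
move=> cf; have /continuous_closedP/(_ _ (@closed_ge _ c)) := cf; exact.
Qed.

Lemma compact_min (T : topologicalType) (R : realType) (f : T -> R) (A : set T) :
  A !=set0 -> compact A -> continuous f ->
  exists2 c, A c & forall t, A t -> f c <= f t.
Proof.
move=> A0 cA /continuous_subspaceT-/(_ A) /(compact_EVT_min A0 cA) [c].
by rewrite inE => Ac minc; exists c => // t At; apply: minc; rewrite inE.
Qed.

Lemma compact_max (T : topologicalType) (R : realType) (f : T -> R) (A : set T) :
  A !=set0 -> compact A -> continuous f ->
  exists2 c, A c & forall t, A t -> f t <= f c.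
Proof.
move=> A0 cA /continuous_subspaceT-/(_ A) /(compact_EVT_max A0 cA) [c].
by rewrite inE => Ac maxc; exists c => // t At; apply: maxc; rewrite inE.
Qed.

Section Minimax.
Variables (R : realType) (E F : topologicalType) (A : set E) (B : set F).
Hypotheses (cA : compact A) (cB : compact B) (A0 : A !=set0) (B0 : B !=set0).

(** Concavity without a linear structure on [E]: a single [y], the same for all [t], does at least
    as well as the point of the segment from [x] to [x']. *)
Definition concavelike (f : E -> F -> R) :=
  forall x x' l, A x -> A x' -> 0 <= l <= 1 ->
  exists2 y, A y & forall t, B t -> (1 - l) * f x t + l * f x' t <= f y t.

(** A maximin point [x] and its minimizer [m x] form the saddle point. A small step from [x] towards
    [x'] cannot lift the minimum above the maximin value [M]. As the step shrinks, the best
    responses accumulate at a minimizer of [f x], which uniqueness identifies with [m x]. *)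
Lemma saddle_unique_minimizer (f : E -> F -> R) :
  (forall t, continuous (f^~ t)) -> (forall x, continuous (f x)) ->
  concavelike f ->
  (forall x t t', A x -> B t -> B t' -> (forall s, B s -> f x t <= f x s) ->
     (forall s, B s -> f x t' <= f x s) -> t = t') ->
  exists x t, [/\ A x, B t &
    forall x' t', A x' -> B t' -> f x' t <= f x t'].
Proof.
move=> cE cF concf uniqf.
have /choice [m mP] : forall x, exists t,
    B t /\ forall s, B s -> f x t <= f x s.
  by move=> x; have [t Bt mt] := compact_min B0 cB (cF x); exists t.
have Bm x : B (m x) by have [] := mP x.
have fm x s : B s -> f x (m x) <= f x s by have [_] := mP x; apply.
pose D := [set f x (m x) | x in A].
have Dsup : has_sup D.
  split; first by have [x Ax] := A0; exists (f x (m x)), x.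
  have [t Bt] := B0; have [c Ac mc] := compact_max A0 cA (cE t).
  by exists (f c t) => _ [x Ax <-]; apply: le_trans (fm _ _ Bt) (mc _ Ax).
pose M := sup D.
have leM x : A x -> f x (m x) <= M.
  by move=> Ax; apply: (ub_le_sup Dsup.2); exists x.
(* The supremum [M] is attained: the sets where every payoff is at least [M - e] are closed and, by
   adherence of the supremum, meet [A]. *)
have [x Ax Mx] : exists2 x, A x & forall t, B t -> M <= f x t.
  have [||e e'|x Ax xP] := @compact_nested _ R A
      (fun e => [set x | forall t, B t -> M - e <= f x t]) cA.
  - by move=> e e0; apply: closed_forall_in => t _; apply: closed_ge_continuous.
  - move=> e e0; have [_ [x Ax <-] xP] := sup_adherent e0 Dsup.
    by exists x; split=> // t Bt; rewrite ltW// (lt_le_trans xP)// fm.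
  - by move=> e0 ee' x xP t Bt; apply: le_trans (xP t Bt); rewrite lerB.
  exists x => // t Bt; apply/ler_addgt0Pr => e e0.
  by rewrite -lerBlDr; apply: xP.
exists x, (m x); split=> // x' t' Ax' Bt'; apply: le_trans (Mx _ Bt').
(* It remains to bound [f x' (m x)] by [M]. The approximating points are best responses to
   strategies slightly displaced from [x] towards [x']. *)
have [||e e'|t Bt tP] := @compact_nested _ R B
    (fun e => [set t | f x' t <= M] `&` [set t | f x t <= M + e]) cB.
- by move=> e e0; apply: closedI; exact: closed_le_continuous.
- move=> e e0.
  have [c _ cmax] : exists2 c, B c &
      forall t, B t -> f x t - f x' t <= f x c - f x' c.
    apply: (compact_max (f := fun t => f x t - f x' t) B0 cB) => t.
    by apply: cvgB; apply: cF.
  pose d := `|f x c - f x' c|.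
  have d0 : 0 <= d by exact: normr_ge0.
  have dP t : B t -> f x t - f x' t <= d.
    by move=> Bt; apply: le_trans (cmax _ Bt) (ler_norm _).
  (* A step length with [l * d <= e]. At [m y] the weighted mean of [f x] and [f x'] is at most [M]
     while [f x] is at least [M]. Hence [f x' (m y) <= M] and [f x (m y) <= M + l * d]. *)
  pose l := e / (d + e).
  have de0 : 0 < d + e by lra.
  have l0 : 0 < l by rewrite divr_gt0.
  have l1 : l <= 1 by rewrite ler_pdivrMr // mul1r; lra.
  have [|y Ay yP] := concf x x' l Ax Ax'; first by rewrite ltW.
  have h1 := le_trans (yP _ (Bm y)) (leM _ Ay).
  have h2 := Mx _ (Bm y); have h3 := dP _ (Bm y).
  exists (m y); split=> //; split=> /=; first by nra.
  have : l * d <= e.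
    by rewrite /l mulrAC ler_pdivrMr // ler_pM2l //; lra.
  by nra.
- by move=> e0 ee' t [h1 h2]; split=> //=; apply: le_trans h2 _; rewrite lerD2l.
(* In the limit [f x t <= M], and [M] is a lower bound of [f x] on [B], so [t] minimizes [f x]. *)
have [fx't _] := tP 1 ltr01.
have fxt : f x t <= M.
  by apply/ler_addgt0Pr => e e0; have [_] := tP e e0.
suff -> : m x = t by [].
apply: (uniqf x) => // s Bs; first exact: fm.
by apply: le_trans fxt (Mx _ Bs).
Qed.

(** For [k > 0] the payoff [f + k * h] has unique minimizers on [B], and its saddle points are
    saddle points of [f] up to an error [k * d], where [d] is the oscillation of [h] on [B].
    Compactness of the product removes the error. *)
Theorem saddle_midpoint_convex (f : E -> F -> R) (h : F -> R) :
  (forall t, continuous (f^~ t)) -> (forall x, continuous (f x)) ->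
  continuous h -> concavelike f ->
  (forall t t', B t -> B t' -> t <> t' -> exists u,
     [/\ B u, forall x, A x -> f x u <= (f x t + f x t') / 2
            & h u < (h t + h t') / 2]) ->
  exists x t, [/\ A x, B t &
    forall x' t', A x' -> B t' -> f x' t <= f x t'].
Proof.
move=> cE cF ch concf convf.
have [hM BhM hMP] := compact_max B0 cB ch.
have [hm Bhm hmP] := compact_min B0 cB ch.
pose d := h hM - h hm.
have dP t t' : B t -> B t' -> h t - h t' <= d.
  by move=> Bt Bt'; rewrite lerB // ?hMP ?hmP.
have d0 : 0 <= d by rewrite subr_ge0 hMP.
have [||e e'|[x t] [Ax Bt] xtP] := @compact_nested _ R (A `*` B)
    (fun e => [set p | forall q : E * F, (A `*` B) q -> f q.1 p.2 - f p.1 q.2 <= e])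
    (compact_setX cA cB).
- move=> e e0; apply: closed_forall_in => q _; apply: closed_le_continuous => p.
  apply: cvgB.
    by apply: (@continuous_comp _ _ _ snd (f q.1)); [exact: cvg_snd|exact: cF].
  by apply: (@continuous_comp _ _ _ fst (f^~ q.2)); [exact: cvg_fst|exact: cE].
(* Chosen so that [k * d <= e]; the [+ 1] keeps the denominator positive when [h] is constant on
   [B]. *)
- move=> e e0; pose k := e / (d + 1).
  have k0 : 0 < k by rewrite divr_gt0 //; lra.
  have kd : k * d <= e by rewrite /k mulrAC ler_pdivrMr ?ler_pM2l //; lra.
  have [| | |x t t' Ax Bt Bt' mt mt'|x [t [Ax Bt xtP]]] :=
      @saddle_unique_minimizer (fun x t => f x t + k * h t).
  + by move=> t x; apply: cvgD; [exact: cE|exact: cvg_cst].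
  + by move=> x t; apply: cvgD; [exact: cF|apply: cvgM; [exact: cvg_cst|exact: ch]].
  + move=> x x' l Ax Ax' l01; have [y Ay yP] := concf x x' l Ax Ax' l01.
    by exists y => // t Bt; have := yP t Bt; lra.
  (* Two distinct minimizers would both be beaten by [u], where [k * h] lies strictly below its
     mean. *)
  + apply: contrapT => /(convf _ _ Bt Bt') [u [Bu fu hu]].
    have := mt _ Bu; have := mt' _ Bu; have := fu _ Ax.
    have : k * h u < k * ((h t + h t') / 2) by rewrite ltr_pM2l.
    lra.
  exists (x, t); split=> // -[x' t'] [/= Ax' Bt'].
  have := xtP _ _ Ax' Bt'; have := dP _ _ Bt' Bt; nra.
- by move=> e0 ee' p pP q qAB; apply: le_trans (pP q qAB) ee'.
exists x, t; split=> // x' t' Ax' Bt'; apply/ler_addgt0Pr => e e0.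
by rewrite -lerBlDl; apply: (xtP e e0 (x', t')).
Qed.

End Minimax.

Local Open Scope complex_scope.
Local Open Scope sesquilinear_scope.

(** * Positive semidefinite complex matrices *)

Section NonnegativeForms.
Variable R : realType.
Local Notation C := R[i].

Lemma hermsymmxP n (A : 'M[C]_n) : reflect (A^t* = A) (A \is hermsymmx).
Proof.
apply: (iffP idP) => [/is_hermitianmxP|AE].
  by rewrite expr0 scale1r => <-.
by apply/is_hermitianmxP; rewrite expr0 scale1r AE.
Qed.

Lemma adjmxM m n p (A : 'M[C]_(m, n)) (B : 'M[C]_(n, p)) :
  (A *m B)^t* = B^t* *m A^t*.
Proof. by rewrite trmx_mul map_mxM. Qed.

Lemma adjmxD m n (A B : 'M[C]_(m, n)) : (A + B)^t* = A^t* + B^t*.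
Proof. by rewrite linearD /= map_mxD. Qed.

Lemma adjmxZ m n (k : C) (A : 'M[C]_(m, n)) : (k *: A)^t* = k^*%R *: A^t*.
Proof. by rewrite linearZ /= map_mxZ. Qed.

(** A nonzero row vector [v] with [v *m A = 0] would make the form vanish at [v^t*]. *)
Lemma pdmx_unit n (A : 'M[C]_n) : pdmx A -> A \in unitmx.
Proof.
case=> _ Apos; rewrite unitmxE unitfE; apply/negP => /det0P [v v0 vA].
have vc0 : v^t* != 0.
  by apply: contra v0 => /eqP v0; rewrite -(trmxCK v) v0 trmx0 map_mx0.
by have := Apos _ vc0; rewrite trmxCK vA mul0mx mxE ltxx.
Qed.

(** With [y = invmx A *m x], the form of the inverse at [x] is the form of [A] at [y]. *)
Lemma pdmx_inv_form_ge0 n (A : 'M[C]_n) (x : 'cV[C]_n) :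
  pdmx A -> 0 <= (x^t* *m invmx A *m x) 0 0.
Proof.
move=> Apd; have Au := pdmx_unit Apd; case: (Apd) => /hermsymmxP AH Apos.
pose y := invmx A *m x; have xE : x = A *m y by rewrite mulKVmx.
rewrite -mulmxA -/y xE adjmxM AH.
have [->|/Apos/ltW //] := eqVneq y 0.
by rewrite mulmx0 mxE.
Qed.

Lemma mulmx_form_diag m n (W : 'M[C]_m) (X : 'M[C]_(m, n)) i :
  (X^t* *m W *m X) i i = ((col i X)^t* *m W *m col i X) 0 0.
Proof.
rewrite !mxE; apply: eq_bigr => j _; rewrite !mxE; congr (_ * _).
by apply: eq_bigr => k _; rewrite !mxE.
Qed.

(** Diagonalize [S] by a unitary [P]. By cyclicity, the trace becomes a sum of eigenvalues of [S]
    weighted by values of the form [W] on the columns of [X *m P^t*]. *)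
Lemma mxtrace_psd_ge0 m n (W : 'M[C]_m) (X : 'M[C]_(m, n)) (S : 'M[C]_n) :
  (forall x : 'cV[C]_m, 0 <= (x^t* *m W *m x) 0 0) -> psdmx S ->
  0 <= \tr (X^t* *m W *m X *m S).
Proof.
move=> W0 [/hermitian_normalmx/orthomx_spectralP SE S0].
set P := spectralmx S in SE; set D := spectral_diag S in SE.
have Pu : P \is unitarymx := spectral_unitarymx S.
rewrite invmx_unitary // in SE.
(* An eigenvalue is the value of the form of [S] on the corresponding column of [P^t*]. *)
have D0 i : 0 <= D 0 i.
  suff -> : D 0 i = ((col i (P^t*))^t* *m S *m col i (P^t*)) 0 0 by [].
  rewrite -mulmx_form_diag trmxCK SE !mulmxA mulmxtVK //.
  by rewrite (unitarymxP Pu) mul1mx mxE eqxx.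
rewrite SE !mulmxA mxtrace_mulC !mulmxA -[X in \tr X]/(_ *m _).
have -> : P *m X^t* *m W *m X *m P^t* =
    (X *m P^t*)^t* *m W *m (X *m P^t*) by rewrite adjmxM trmxCK !mulmxA.
apply: sumr_ge0 => i _; rewrite mul_mx_diag mxE.
by rewrite mulr_ge0 // mulmx_form_diag.
Qed.

Lemma psdmxD n (A B : 'M[C]_n) : psdmx A -> psdmx B -> psdmx (A + B).
Proof.
move=> [/hermsymmxP AH A0] [/hermsymmxP BH B0]; split.
  by apply/hermsymmxP; rewrite adjmxD AH BH.
by move=> x; rewrite mulmxDr mulmxDl mxE addr_ge0.
Qed.

Lemma psdmxZ n k (A : 'M[C]_n) : 0 <= k -> psdmx A -> psdmx (k *: A).
Proof.
move=> k0 [/hermsymmxP AH A0]; split.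
  by apply/hermsymmxP; rewrite adjmxZ AH conj_Creal ?ger0_real.
by move=> x; rewrite -scalemxAr -scalemxAl mxE mulr_ge0.
Qed.

Lemma psdmx1 n : psdmx (1%:M : 'M[C]_n).
Proof.
split; first by apply/hermsymmxP; rewrite trmx1 map_mx1.
move=> x; rewrite mulmx1 mxE sumr_ge0 // => i _.
by rewrite !mxE mulrC mul_conjC_ge0.
Qed.

(** The form of [A] evaluated at [e_i + u e_j]. Suitable values of [u] bound an off-diagonal entry
    by the diagonal ones. *)
Lemma psdmx_entry_form n (A : 'M[C]_n) i j (u : C) : psdmx A ->
  0 <= A i i + (u * A i j + (u * A i j)^*%R) + u * u^*%R * A j j.
Proof.
move=> [/hermsymmxP AH A0].
have := A0 (delta_mx i 0 + u *: delta_mx j 0).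
rewrite adjmxD adjmxZ !trmx_delta !map_delta_mx mulmxDl -scalemxAl -!rowE.
rewrite mulmxDl !mulmxDr -!scalemxAl -!scalemxAr -!colE !mxE.
have -> : A j i = (A i j)^*%R by rewrite -[in LHS]AH !mxE.
by rewrite rmorphM; congr (0 <= _); ring.
Qed.

(** The map [q] is the diagonal of the biadditive [b], and the cross terms cancel. *)
Lemma quad_parallelogram m n (W : 'M[C]_m) (S : 'M[C]_n) (X Y : 'M[C]_(m, n)) :
  let q Z := \tr (Z^t* *m W *m Z *m S) in
  q (X + Y) + q (X - Y) = (q X + q Y) *+ 2.
Proof.
pose b (Z Z' : 'M[C]_(m, n)) := \tr (Z^t* *m W *m Z' *m S).
have bDl Z Z' Z'' : b (Z + Z') Z'' = b Z Z'' + b Z' Z''.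
  by rewrite /b adjmxD !mulmxDl mxtraceD.
have bDr Z Z' Z'' : b Z (Z' + Z'') = b Z Z' + b Z Z''.
  by rewrite /b mulmxDr mulmxDl mxtraceD.
have bNl Z Z' : b (- Z) Z' = - b Z Z'.
  by rewrite /b linearN /= map_mxN !mulNmx linearN.
have bNr Z Z' : b Z (- Z') = - b Z Z' by rewrite /b mulmxN mulNmx linearN.
move=> q; have qE Z : q Z = b Z Z by [].
rewrite !qE !bDl !bDr !bNl !bNr mulr2n.
move: (b X X) (b X Y) (b Y X) (b Y Y) => xx xy yx yy.
ring.
Qed.

End NonnegativeForms.

(** * Real coordinates of complex matrices *)

Lemma ReD (R : realType) (x y : R[i]) : Re (x + y) = Re x + Re y.
Proof. by case: x => ? ?; case: y. Qed.

Lemma ImD (R : realType) (x y : R[i]) : Im (x + y) = Im x + Im y.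
Proof. by case: x => ? ?; case: y. Qed.

Lemma ReM (R : realType) (x y : R[i]) :
  Re (x * y) = Re x * Re y - Im x * Im y.
Proof. by case: x => ? ?; case: y. Qed.

Lemma ImM (R : realType) (x y : R[i]) :
  Im (x * y) = Re x * Im y + Im x * Re y.
Proof. by case: x => ? ?; case: y. Qed.

(** * Continuity and closedness for complex-valued maps *)

Section ComplexContinuity.
Variables (R : realType) (T : topologicalType).
Local Notation C := R[i].

(** Stated by components, so that the closedness lemmas for real-valued functions apply directly. *)
Definition ccontinuous (g : T -> C) : Prop :=
  continuous (fun p => Re (g p)) /\ continuous (fun p => Im (g p)).

Lemma ccontinuous_cst c : ccontinuous (fun=> c).
Proof. by split=> p; exact: cvg_cst. Qed.

Lemma ccontinuousD f g :
  ccontinuous f -> ccontinuous g -> ccontinuous (fun p => f p + g p).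
Proof.
move=> [cf1 cf2] [cg1 cg2].
split; [rewrite (funext (fun p => ReD _ _))|rewrite (funext (fun p => ImD _ _))].
  by move=> p; apply: cvgD; [exact: cf1|exact: cg1].
by move=> p; apply: cvgD; [exact: cf2|exact: cg2].
Qed.

Lemma ccontinuousM f g :
  ccontinuous f -> ccontinuous g -> ccontinuous (fun p => f p * g p).
Proof.
move=> [cf1 cf2] [cg1 cg2].
split; [rewrite (funext (fun p => ReM _ _))|rewrite (funext (fun p => ImM _ _))].
  move=> p; apply: cvgB; apply: cvgM;
    by [exact: cf1|exact: cg1|exact: cf2|exact: cg2].
move=> p; apply: cvgD; apply: cvgM;
  by [exact: cf1|exact: cg1|exact: cf2|exact: cg2].
Qed.

Lemma ccontinuous_conj f : ccontinuous f -> ccontinuous (fun p => (f p)^*%R).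
Proof.
move=> [cf1 cf2].
have CRe (x : C) : Re (x^*%R) = Re x by case: x.
have CIm (x : C) : Im (x^*%R) = - Im x by case: x.
split; [rewrite (funext (fun p => CRe _))|rewrite (funext (fun p => CIm _))] => //.
by move=> p; apply: cvgN; exact: cf2.
Qed.

Lemma ccontinuous_sum (I : Type) (r : seq I) (f : I -> T -> C) :
  (forall i, ccontinuous (f i)) -> ccontinuous (fun p => \sum_(i <- r) f i p).
Proof.
move=> cf; elim: r => [|i r IHr].
  by under eq_fun do rewrite big_nil; exact: ccontinuous_cst.
by under eq_fun do rewrite big_cons; exact: ccontinuousD.
Qed.

Lemma closed_cge0 g : ccontinuous g -> closed [set p | 0 <= g p].
Proof.
move=> [cg1 cg2].
(* Nonnegativity in the partial order includes a vanishing imaginary part, written as two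
   inequalities. *)
rewrite (_ : [set _ | _] = [set p | 0 <= Re (g p)] `&`
  ([set p | Im (g p) <= 0] `&` [set p | 0 <= Im (g p)])); last first.
  apply/seteqP; split=> p /=; rewrite lecE /=.
    by move=> /andP[/eqP -> ->].
  by move=> [-> [h1 h2]]; rewrite eq_le h1 h2.
apply: closedI; first exact: closed_ge_continuous.
by apply: closedI; [exact: closed_le_continuous|exact: closed_ge_continuous].
Qed.

Lemma closed_ceq f g : ccontinuous f -> ccontinuous g ->
  closed [set p | f p = g p].
Proof.
move=> cf cg; have cfg : ccontinuous (fun p => f p - g p).
  under eq_fun do rewrite -mulN1r; apply: ccontinuousD => //.
  by apply: ccontinuousM => //; exact: ccontinuous_cst.
have cgf : ccontinuous (fun p => g p - f p).
  under eq_fun do rewrite -mulN1r; apply: ccontinuousD => //.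
  by apply: ccontinuousM => //; exact: ccontinuous_cst.
rewrite (_ : [set _ | _] = [set p | 0 <= f p - g p] `&` [set p | 0 <= g p - f p]).
  by apply: closedI; exact: closed_cge0.
apply/seteqP; split=> p /=; first by move=> ->; rewrite subrr.
by rewrite !subr_ge0 => -[h1 h2]; apply/eqP; rewrite eq_le h1 h2.
Qed.

Definition mxcontinuous m n (X : T -> 'M[C]_(m, n)) : Prop :=
  forall i j, ccontinuous (fun p => X p i j).

Lemma mxcontinuous_cst m n (X : 'M[C]_(m, n)) : mxcontinuous (fun=> X).
Proof. by move=> i j; exact: ccontinuous_cst. Qed.

Lemma mxcontinuousM m n k (X : T -> 'M[C]_(m, n)) (Y : T -> 'M[C]_(n, k)) :
  mxcontinuous X -> mxcontinuous Y -> mxcontinuous (fun p => X p *m Y p).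
Proof.
move=> cX cY i j; under eq_fun do rewrite mxE.
by apply: ccontinuous_sum => l; exact: ccontinuousM.
Qed.

Lemma mxcontinuous_adj m n (X : T -> 'M[C]_(m, n)) :
  mxcontinuous X -> mxcontinuous (fun p => (X p)^t*).
Proof.
by move=> cX i j; under eq_fun do rewrite !mxE; exact: ccontinuous_conj.
Qed.

Lemma ccontinuous_mxtrace n (X : T -> 'M[C]_n) :
  mxcontinuous X -> ccontinuous (fun p => \tr (X p)).
Proof. by move=> cX; apply: ccontinuous_sum => i; exact: cX. Qed.

Lemma closed_psdmx n (X : T -> 'M[C]_n) :
  mxcontinuous X -> closed [set p | psdmx (X p)].
Proof.
move=> cX.
rewrite (_ : [set _ | _] =
  [set p | forall i j, (X p)^t* i j = X p i j] `&`
  [set p | forall x : 'cV[C]_n, 0 <= (x^t* *m X p *m x) 0 0]).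
  apply: closedI.
    do 2!apply: closed_forall => ?.
    by apply: closed_ceq; [exact: mxcontinuous_adj|exact: cX].
  apply: closed_forall => x; apply: closed_cge0.
  apply: mxcontinuousM; last exact: mxcontinuous_cst.
  by apply: mxcontinuousM => //; exact: mxcontinuous_cst.
apply/seteqP; split=> p [/=].
  by move=> /hermsymmxP XH X0; split=> // i j; rewrite XH.
by move=> XH X0; split=> //; apply/hermsymmxP/matrixP.
Qed.

End ComplexContinuity.

(** * Complex matrices as pairs of real row vectors *)

Section ComplexMatrixCoordinates.
Variables (R : realType) (m n : nat).
Local Notation C := R[i].
Local Notation coords := ('rV[R]_(m * n) * 'rV[R]_(m * n))%type.

Definition mx_of_coords (p : coords) : 'M[C]_(m, n) :=
  \matrix_(i, j) (vec_mx p.1 i j +i* vec_mx p.2 i j).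

Definition coords_of_mx (X : 'M[C]_(m, n)) : coords :=
  (mxvec (map_mx (@Re R) X), mxvec (map_mx (@Im R) X)).

Lemma coords_of_mxK : cancel coords_of_mx mx_of_coords.
Proof.
by move=> X; apply/matrixP => i j; rewrite !mxE !mxvecE !mxE; case: (X i j).
Qed.

Lemma mx_of_coordsK : cancel mx_of_coords coords_of_mx.
Proof.
case=> u v; congr pair; rewrite -[RHS]vec_mxK; congr mxvec;
  by apply/matrixP => i j; rewrite !mxE.
Qed.

Lemma mxcontinuous_of_coords : mxcontinuous mx_of_coords.
Proof.
move=> i j; split=> p; under eq_fun do rewrite !mxE /=.
  by apply: (@continuous_comp _ _ _ fst (fun v : 'rV[R]_(m * n) => v 0 (mxvec_index i j)));
    [exact: cvg_fst|exact: coord_continuous].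
by apply: (@continuous_comp _ _ _ snd (fun v : 'rV[R]_(m * n) => v 0 (mxvec_index i j)));
    [exact: cvg_snd|exact: coord_continuous].
Qed.

(** Heine-Borel: the preimage is a closed subset of a product of two boxes. *)
Lemma compact_of_coords (A : set 'M[C]_(m, n)) (c : 'M[R]_(m, n)) :
  closed (mx_of_coords @^-1` A) ->
  (forall X, A X -> forall i j,
     `|Re (X i j)| <= c i j /\ `|Im (X i j)| <= c i j) ->
  compact (mx_of_coords @^-1` A).
Proof.
move=> clA bA; pose box := [set v : 'rV[R]_(m * n) |
  forall k, `[- mxvec c 0 k, mxvec c 0 k]%classic (v ord0 k)].
have cbox : compact box.
  apply: (@rV_compact R _ (fun k => `[- mxvec c 0 k, mxvec c 0 k]%classic)) => k.
  exact: segment_compact.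
apply: (subclosed_compact clA (compact_setX cbox cbox)) => -[u v] /bA h.
split=> /= k; case/mxvec_indexP: k => i j; have := h i j;
  by rewrite !mxE /= mxvecE in_itv /= -ler_norml => -[].
Qed.

End ComplexMatrixCoordinates.

(** * The radar game *)

(** The inner maximum at [t] is [f x t]. At any other [s] in [B] it is at least [f x s], hence at
    least [f x t]. *)
Lemma nash_minmax (d : Order.disp_t) (V : porderType d) (S T : Type)
    (A : set S) (B : set T) (f : S -> T -> V) x t :
  is_nash A B f x t -> (forall t, B t -> exists v, is_max_on A (f^~ t) v) ->
  is_minmax A B f (f x t).
Proof.
move=> [Ax Bt xtP] maxf.
have /choice [phi phiP] : forall t, exists v, B t -> is_max_on A (f^~ t) v.
  move=> s; have [/maxf [v vP]|nBs] := pselect (B s); first by exists v.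
  (* An arbitrary value, since [phi] is only constrained on [B]. *)
  by exists (f x t).
exists phi => //; split.
  exists t => //; have [[y Ay <-] ub] := phiP t Bt.
  apply/le_anti/andP; split; last by apply: ub; exists x.
  by have /andP[] := xtP y t Ay Bt.
move=> _ [s Bs <-]; have [_ ub] := phiP s Bs.
apply: le_trans (ub (f x s) _); last by exists x.
by have /andP[] := xtP x s Ax Bs.
Qed.

Lemma nash_maxmin (d : Order.disp_t) (V : porderType d) (S T : Type)
    (A : set S) (B : set T) (f : S -> T -> V) x t :
  is_nash A B f x t -> (forall x, A x -> exists v, is_min_on B (f x) v) ->
  is_maxmin A B f (f x t).
Proof.
move=> [Ax Bt xtP] minf.
have /choice [psi psiP] : forall y, exists v, A y -> is_min_on B (f y) v.
  move=> y; have [/minf [v vP]|nAy] := pselect (A y); first by exists v.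
  by exists (f x t).
exists psi => //; split.
  exists x => //; have [[s Bs <-] lb] := psiP x Ax.
  apply/le_anti/andP; split; first by apply: lb; exists t.
  by have /andP[] := xtP x s Ax Bs.
move=> _ [y Ay <-]; have [_ lb] := psiP y Ay.
apply: le_trans (lb (f y t) _) _; first by exists t.
by have /andP[] := xtP y t Ay Bt.
Qed.

(** * Linearity, positivity and continuity of the payoff *)

Section Radar.
Variables (R : realType) (NT NR L Q : nat).
Local Notation C := R[i].
Variables (a : 'cV[C]_NT) (b : 'cV[C]_NR) (Rc : 'M[C]_((Q + L - 1) * NR)).
Hypothesis hRc : pdmx Rc.

Lemma GmxD (s t : 'cV[C]_Q) : Gmx L a b (s + t) = Gmx L a b s + Gmx L a b t.
Proof.
apply/matrixP => i j; rewrite /Gmx !mxE -mulrDl; congr (_ * _).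
rewrite /tirmx !summxE -big_split; apply: eq_bigr => k _ /=.
by rewrite !mxE mulrDl.
Qed.

Lemma GmxZ k (t : 'cV[C]_Q) : Gmx L a b (k *: t) = k *: Gmx L a b t.
Proof.
apply/matrixP => i j; rewrite /Gmx !mxE mulrA; congr (_ * _).
rewrite /tirmx !summxE mulr_sumr; apply: eq_bigr => l _ /=.
by rewrite !mxE mulrA.
Qed.

Lemma zC_ge0 S t : psdmx S -> 0 <= zC a b Rc S t.
Proof. by move=> ?; apply: mxtrace_psd_ge0 => // x; exact: pdmx_inv_form_ge0. Qed.

Lemma zCDl S S' t : zC a b Rc (S + S') t = zC a b Rc S t + zC a b Rc S' t.
Proof. by rewrite /zC mulmxDr mxtraceD. Qed.

Lemma zCZl k S t : zC a b Rc (k *: S) t = k * zC a b Rc S t.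
Proof. by rewrite /zC -scalemxAr mxtraceZ. Qed.

Lemma zCZr k S t : zC a b Rc S (k *: t) = (k * k^*%R) * zC a b Rc S t.
Proof.
rewrite /zC GmxZ adjmxZ -!(scalemxAl, scalemxAr) !mxtraceZ mulrA.
by rewrite [k * _]mulrC.
Qed.

(** By the parallelogram identity, the two sides differ by the payoff at the half-difference of [s]
    and [t], which is nonnegative. *)
Lemma zC_midpoint S s t : psdmx S ->
  zC a b Rc S (2^-1 *: (s + t)) <= (zC a b Rc S s + zC a b Rc S t) / 2.
Proof.
move=> Spsd; have := zC_ge0 (2^-1 *: (s - t)) Spsd.
have cV2 : ((2^-1 : C)^*)%R = 2^-1 by rewrite conj_Creal ?ger0_real ?invr_ge0 ?ler0n.
have par : zC a b Rc S (s + t) + zC a b Rc S (s - t) =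
    (zC a b Rc S s + zC a b Rc S t) *+ 2.
  rewrite /zC -[- t]scaleN1r !GmxD GmxZ scaleN1r.
  exact: quad_parallelogram.
rewrite !zCZr cV2.
have -> : zC a b Rc S (s + t) =
    (zC a b Rc S s + zC a b Rc S t) *+ 2 - zC a b Rc S (s - t).
  by rewrite -par addrK.
move=> D0; rewrite -subr_ge0; apply: le_trans D0 _.
move: (zC _ _ _ _ s) (zC _ _ _ _ t) (zC _ _ _ _ (s - t)) => x y z.
by rewrite le_eqVlt; apply/orP; left; apply/eqP; field.
Qed.

Lemma zC_continuousl t :
  ccontinuous (fun p => zC a b Rc (mx_of_coords p) t).
Proof.
apply: ccontinuous_mxtrace; apply: mxcontinuousM; first exact: mxcontinuous_cst.
exact: mxcontinuous_of_coords.
Qed.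

Lemma zC_continuousr S :
  ccontinuous (fun p => zC a b Rc S (mx_of_coords p)).
Proof.
have cG : mxcontinuous (fun p => Gmx L a b (mx_of_coords p : 'cV[C]_Q)).
  move=> i j; pose i1 := mxtens_unindex i; pose j1 := mxtens_unindex j.
  (* Each entry of the Kronecker product is an explicit linear expression in the entries of the
     target response. *)
  have -> : (fun p => Gmx L a b (mx_of_coords p : 'cV[C]_Q) i j) = (fun p =>
      (\sum_k mx_of_coords p k 0 * shiftmx R L Q k i1.1 j1.1) *
      (b *m a^T) i1.2 j1.2).
    apply/funext => p; rewrite /Gmx /tensmx /tirmx !mxE summxE.
    by congr (_ * _); apply: eq_bigr => k _; rewrite mxE.
  apply: ccontinuousM; last exact: ccontinuous_cst.
  apply: ccontinuous_sum => k; apply: ccontinuousM; last exact: ccontinuous_cst.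
  exact: mxcontinuous_of_coords.
apply: ccontinuous_mxtrace; apply: mxcontinuousM; last exact: mxcontinuous_cst.
apply: mxcontinuousM (cG); apply: mxcontinuousM; last exact: mxcontinuous_cst.
exact: mxcontinuous_adj.
Qed.

End Radar.

(** * The radar player's strategy set *)

Section Waveforms.
Variables (R : realType) (NT L : nat) (et : R).
Local Notation C := R[i].
Local Notation c := (et / (NT * L)%:R).

Lemma waveforms_nonempty : 0 < et -> waveforms NT L et !=set0.
Proof.
move=> et0; exists (c%:C *: 1%:M); split=> [|i].
  by apply: psdmxZ; [rewrite ler0c divr_ge0 ?ler0n ?ltW|exact: psdmx1].
by rewrite !mxE eqxx mulr1.
Qed.

Lemma waveforms_convex (S S' : 'M[C]_(L * NT)) (l : R) : 0 <= l <= 1 ->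
  waveforms NT L et S -> waveforms NT L et S' ->
  waveforms NT L et ((1 - l)%:C *: S + l%:C *: S').
Proof.
move=> /andP[l0 l1] [Spsd SD] [S'psd S'D]; split=> [|i].
  by apply: psdmxD; apply: psdmxZ; rewrite ?ler0c ?subr_ge0.
by rewrite !mxE SD S'D -mulrDl -rmorphD /= subrK mul1r.
Qed.

(** With both diagonal entries equal to [c], the values 1 and -1 of [u] in [psdmx_entry_form] bound
    the real part, and the two imaginary units bound the imaginary part. *)
Lemma waveforms_bounded S : waveforms NT L et S ->
  forall i j, `|Re (S i j)| <= c /\ `|Im (S i j)| <= c.
Proof.
move=> [Spsd SD] i j; have h u := psdmx_entry_form i j u Spsd.
have := h 1; have := h (-1); have := h 'i%C; have := h (- 'i%C).
rewrite !SD; case: (S i j) => x y; simpc => /=; move: (c) => k h1 h2 h3 h4.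
by split; rewrite ler_norml; apply/andP; split; lra.
Qed.

Lemma waveforms_compact :
  compact (@mx_of_coords R (L * NT) (L * NT) @^-1` waveforms NT L et).
Proof.
apply: (@compact_of_coords _ _ _ _ (const_mx c)); last first.
  by move=> S /waveforms_bounded h i j; rewrite !mxE.
have cX := @mxcontinuous_of_coords R (L * NT) (L * NT).
apply: closedI; first exact: closed_psdmx.
apply: closed_forall => i; apply: closed_ceq => //.
exact: ccontinuous_cst.
Qed.

End Waveforms.

(** * The target player's strategy set *)

Section Tirs.
Variables (R : realType) (Q : nat).
Local Notation C := R[i].

(** The square of [l2norm] as a polynomial in real coordinates. Centred at [t0], it also serves as
    the strictly convex perturbation. *)
Definition sqnorm (x : 'cV[C]_Q) : R :=
  \sum_i (Re (x i 0) ^+ 2 + Im (x i 0) ^+ 2).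

Lemma sqnorm_ge0 x : 0 <= sqnorm x.
Proof. by apply: sumr_ge0 => i _; rewrite addr_ge0 ?sqr_ge0. Qed.

Lemma sqnorm_eq0 x : sqnorm x = 0 -> x = 0.
Proof.
move=> /eqP; rewrite psumr_eq0 => [/allP x0|i _]; last by rewrite addr_ge0 ?sqr_ge0.
apply/matrixP => i j; rewrite ord1 mxE.
have /= := x0 i (mem_index_enum _).
rewrite paddr_eq0 ?sqr_ge0 // !sqrf_eq0 => /andP[/eqP r0 /eqP i0].
by apply/eqP; rewrite eq_complex r0 i0 /= eqxx.
Qed.

(** The parallelogram identity again; the second term on the left measures the strictness of
    midpoint convexity. *)
Lemma sqnorm_midpoint x y :
  sqnorm (2^-1 *: (x + y)) + sqnorm (2^-1 *: (x - y)) = (sqnorm x + sqnorm y) / 2.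
Proof.
rewrite /sqnorm -!big_split mulr_suml; apply: eq_bigr => i _ /=.
rewrite !mxE (_ : 2^-1 = (2^-1)%:C); last by rewrite fmorphV rmorph_nat.
case: (x i 0) => x1 x2; case: (y i 0) => y1 y2; simpc => /=.
by field.
Qed.

Lemma tirsE (t0 : 'cV[C]_Q) (r : R) : 0 <= r ->
  tirs t0 r = [set t | sqnorm (t - t0) <= r ^+ 2].
Proof.
move=> r0; have l2E x : l2norm x = Num.sqrt (sqnorm x).
  congr Num.sqrt; apply: eq_bigr => i _; case: (x i 0) => u v /=.
  by rewrite sqr_sqrtr ?addr_ge0 ?sqr_ge0.
apply/seteqP; split=> t; rewrite /tirs /= l2E => h.
  by rewrite -[sqnorm _]sqr_sqrtr ?sqnorm_ge0 // lerXn2r ?nnegrE ?sqrtr_ge0.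
by rewrite -(ger0_norm r0) -sqrtr_sqr ler_wsqrtr.
Qed.

Lemma sqnorm_continuous (t0 : 'cV[C]_Q) :
  continuous (fun p => sqnorm (mx_of_coords p - t0)).
Proof.
have cX : mxcontinuous (fun p => mx_of_coords p - t0).
  move=> i j; under eq_fun do rewrite mxE.
  by apply: ccontinuousD; [exact: mxcontinuous_of_coords|exact: ccontinuous_cst].
apply: continuous_big => [|i _]; first exact: add_continuous.
have [c1 c2] := cX i 0; under eq_fun do rewrite !expr2.
by move=> p; apply: cvgD; apply: cvgM; [exact: c1|exact: c1|exact: c2|exact: c2].
Qed.

Lemma tirs_compact (t0 : 'cV[C]_Q) (r : R) : 0 <= r ->
  compact (@mx_of_coords R Q 1 @^-1` tirs t0 r).
Proof.
(* One bound has to serve for both the real and the imaginary part of an entry, hence the sum of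
   both absolute values of the centre. *)
move=> r0; apply: (@compact_of_coords _ _ _ _
  (\matrix_(i, j) (r + `|Re (t0 i j)| + `|Im (t0 i j)|))).
  by rewrite tirsE //; apply: closed_le_continuous; exact: sqnorm_continuous.
rewrite tirsE // => t /= ht i j; rewrite ord1 mxE.
have : Re ((t - t0) i 0) ^+ 2 + Im ((t - t0) i 0) ^+ 2 <= r ^+ 2.
  apply: le_trans ht; rewrite /sqnorm (bigD1 i) //= lerDl.
  by apply: sumr_ge0 => k _; rewrite addr_ge0 ?sqr_ge0.
rewrite !mxE; case: (t i 0) => x y; case: (t0 i 0) => x0 y0 /= h.
have norm_le u v : u ^+ 2 + v ^+ 2 <= r ^+ 2 -> `|u| <= r.
  move=> uv; rewrite -(@ler_pXn2r _ 2) ?nnegrE // real_normK ?num_real //.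
  by apply: le_trans uv; rewrite lerDl sqr_ge0.
have h1 := norm_le _ _ h; have h2 : `|y - y0| <= r.
  by apply: (norm_le _ (x - x0)); rewrite addrC.
have := ler_normD (x - x0) x0; have := ler_normD (y - y0) y0.
rewrite !subrK; have := normr_ge0 x0; have := normr_ge0 y0.
by split; lra.
Qed.

End Tirs.

(** * Equilibrium of the radar game and equality of its two values *)

Theorem mainTheorem3 (R : realType) (NT NR L Q : nat)
    (hNT : (1 <= NT)%N) (hNR : (1 <= NR)%N) (hL : (1 <= L)%N) (hQ : (1 <= Q)%N)
    (a : 'cV[R[i]]_NT) (b : 'cV[R[i]]_NR)
    (Rc : 'M[R[i]]_((Q + L - 1) * NR)) (hRc : pdmx Rc)
    (et r : R) (het : 0 < et) (hr : 0 < r) (t0 : 'cV[R[i]]_Q) :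
  (exists v : R,
      is_minmax (waveforms NT L et) (tirs t0 r) (zC a b Rc) v%:C /\
      is_maxmin (waveforms NT L et) (tirs t0 r) (zC a b Rc) v%:C) /\
  (exists Rs t, is_nash (waveforms NT L et) (tirs t0 r) (zC a b Rc) Rs t).
Proof.
set A := waveforms NT L et; set B := tirs t0 r; set z := zC a b Rc.
(* On admissible waveforms the payoff is real, so comparisons in [R[i]] reduce to comparisons of
   real parts. *)
have zRe S t : A S -> z S t = (Re (z S t))%:C.
  by move=> [Spsd _]; rewrite RRe_real // ger0_real // zC_ge0.
have z_le S t S' t' : A S -> A S' -> (z S t <= z S' t') = (Re (z S t) <= Re (z S' t')).
  by move=> AS AS'; rewrite (zRe S t) // (zRe S' t') // lecR.
have ReZ (k : R) (w : R[i]) : Re (k%:C * w) = k * Re w.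
  by rewrite ReM /= mul0r subr0.
(* The game is pulled back to real coordinates, where the minimax theorem applies. *)
pose mxS := @mx_of_coords R (L * NT) (L * NT).
pose mxt := @mx_of_coords R Q 1.
pose f p q := Re (z (mxS p) (mxt q)).
have cA : compact (mxS @^-1` A) by exact: waveforms_compact.
have cB : compact (mxt @^-1` B) by apply: tirs_compact; exact: ltW.
have A0 : mxS @^-1` A !=set0.
  have [S AS] := waveforms_nonempty NT L het.
  by exists (coords_of_mx S); rewrite /= /mxS coords_of_mxK.
have B0 : mxt @^-1` B !=set0.
  exists (coords_of_mx t0); rewrite /= /mxt coords_of_mxK /B tirsE ?ltW //= subrr.
  rewrite /sqnorm big1 ?sqr_ge0 // => i _.
  by rewrite mxE /= expr0n addr0.
have cE q : continuous (f^~ q) by have [] := zC_continuousl a b Rc (mxt q).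
have cF p : continuous (f p) by have [] := zC_continuousr a b Rc (mxS p).
have [||p [q [Ap Bq pqP]]] :=
    saddle_midpoint_convex cA cB A0 B0 cE cF (@sqnorm_continuous R Q t0).
- move=> p p' l Ap Ap' l01.
  exists (coords_of_mx ((1 - l)%:C *: mxS p + l%:C *: mxS p')).
    by rewrite /= /mxS coords_of_mxK; exact: waveforms_convex.
  move=> q _; rewrite /f {3}/mxS coords_of_mxK /z zCDl !zCZl.
  by rewrite -!ReZ -ReD.
- move=> q q' Bq Bq' qq'.
  pose u := 2^-1 *: (mxt q + mxt q').
  have uE : sqnorm (u - t0) < (sqnorm (mxt q - t0) + sqnorm (mxt q' - t0)) / 2.
    have -> : u - t0 = 2^-1 *: ((mxt q - t0) + (mxt q' - t0)).
      rewrite addrACA -opprD scalerBr; congr (_ - _).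
      have -> : t0 + t0 = 2 *: t0 by rewrite scaler_nat mulr2n.
      by rewrite scalerA mulVf ?scale1r ?pnatr_eq0.
    (* Strictness: a zero half-difference would give equal vectors, hence equal coordinates, against
       [qq']. *)
    rewrite -sqnorm_midpoint ltrDl lt0r sqnorm_ge0 andbT; apply/eqP => /sqnorm_eq0.
    rewrite opprB addrA subrK => /eqP; rewrite scaler_eq0 invr_eq0 pnatr_eq0 /=.
    by rewrite subr_eq0 => /eqP /(can_inj (@mx_of_coordsK _ _ _)).
  exists (coords_of_mx u); rewrite /f {1 2}/mxt coords_of_mxK; split.
  (* The midpoint stays in the ball: its squared distance to [t0] is below the mean of two numbers
     that are at most [r ^+ 2]. *)
  + move: Bq Bq'; rewrite /= coords_of_mxK /B !tirsE ?ltW //= => h1 h2.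
    by apply: le_trans (ltW uE) _; lra.
  + move=> p Ap; have := zC_midpoint a b hRc (mxt q) (mxt q') Ap.1.
    rewrite -/z (zRe _ (mxt q)) // (zRe _ (mxt q')) // (zRe _ (_ *: _)) //.
    by rewrite -rmorphD -(rmorph_nat (real_complex R)) -fmorphV -rmorphM lecR.
  + exact: uE.
have nash : is_nash A B z (mxS p) (mxt q).
  split=> // S t AS Bt; rewrite !z_le //.
  rewrite -(coords_of_mxK S) -(coords_of_mxK t).
  by apply/andP; split; apply: pqP; rewrite // /= /mxS /mxt coords_of_mxK.
split; last by exists (mxS p), (mxt q).
(* The common value is the equilibrium payoff; the inner extrema exist by compactness. *)
exists (Re (z (mxS p) (mxt q))); rewrite -zRe //; split.
  apply: (nash_minmax nash) => t Bt.
  have [p' Ap' maxp'] := compact_max A0 cA (cE (coords_of_mx t)).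
  exists (z (mxS p') t); split; first by exists (mxS p').
  move=> _ [S AS <-]; rewrite z_le //.
  by have := maxp' (coords_of_mx S); rewrite /f /= /mxS /mxt !coords_of_mxK; apply.
apply: (nash_maxmin nash) => S AS.
have [q' Bq' minq'] := compact_min B0 cB (cF (coords_of_mx S)).
exists (z S (mxt q')); split; first by exists (mxt q').
move=> _ [t Bt <-]; rewrite (z_le _ _ _ _ AS AS).
by have := minq' (coords_of_mx t); rewrite /f /= /mxS /mxt !coords_of_mxK; apply.
Qed.
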